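(* Let $X$ and $Y$ be real Banach spaces such that $Y$ has the Radon-Nikodým property. Then $\mathrm{LipA}(X,Y)$ is dense in $\mathrm{Lip}_0(X,Y)$.
   Context: $\mathrm{Lip}_0(X,Y)$ is the real Banach space of all Lipschitz maps $f\colon X\to Y$ with $f(0)=0$, endowed with the norm $\|f\|_{\mathrm{Lip}}=\sup\{\|f(x)-f(y)\|/\|x-y\| : x,y\in X,\ x\neq y\}$. $\mathrm{LipA}(X,Y)$ is the set of those $f\in\mathrm{Lip}_0(X,Y)$ for which there exist a sequence of pairs $((x_n,y_n))$ in $\{(x,y)\in X^2: x\neq y\}$ and a vector $u\in Y$ with $\|u\|=\|f\|_{\mathrm{Lip}}$ such that $\frac{f(x_n)-f(y_n)}{\|x_n-y_n\|}\to u$ in norm. A Banach space has the Radon-Nikodým property (RNP) if every nonempty bounded subset of it is dentable, where a set $A$ is dentable if for every $\delta>0$ there is $a\in A$ not belonging to the closed convex hull of $A\setminus\{b:\|b-a\|<\delta\}$.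
   Formalization: X is assumed to be nontrivial (X ≠ {0}); for X = {0} there are no pairs x ≠ y, so LipA(X,Y) is empty while Lip_0(X,Y) = {0}, and the density claim fails. *)

(* Defs.v *)
From HB Require Import structures.
From mathcomp Require Import all_boot all_order all_algebra.
From mathcomp Require Import all_classical all_reals all_analysis.
Set Implicit Arguments.
Unset Strict Implicit.
Unset Printing Implicit Defensive.
Import Order.TTheory GRing.Theory Num.Theory.
Import numFieldNormedType.Exports.
Local Open Scope classical_set_scope.
Local Open Scope ring_scope.

Section Lip0.
Context {R : realType} (X Y : normedModType R).

Definition lip0_pred : {pred X -> Y} :=
  [pred f : X -> Y | `[< lipschitz f /\ f 0 = 0 >]].

Record Lip0 := MkLip0 {
  lip0_fun :> X -> Y;
  lip0_funP : lip0_fun \in lip0_pred }.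

HB.instance Definition _ := [isSub for lip0_fun].
HB.instance Definition _ := [Choice of Lip0 by <:].

Lemma lip0_predP (f : X -> Y) : reflect
  (f 0 = 0 /\ exists M : R, forall x y, `|f x - f y| <= M * `|x - y|)
  (f \in lip0_pred).
Proof.
apply: (iffP (asboolP _)) => -[].
  move=> /pinfty_ex_gt0[M _ Mf] f0; split=> //; exists M => x y.
  exact: (Mf (x, y)).
move=> f0 [M Mf]; split=> //.
apply: (@klipschitzW _ _ _ M _ _ (globally_properfilter (a := (0, 0)) _)) => //.
by move=> [x y] _; exact: Mf.
Qed.

Lemma lip0_submod_closed : submod_closed lip0_pred.
Proof.
split=> [|a f g /lip0_predP[f0 [M Mf]] /lip0_predP[g0 [N Ng]]].
  by apply/lip0_predP; split=> //; exists 0 => x y; rewrite subrr normr0 mul0r.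
apply/lip0_predP; split.
  have E : (a *: f + g) 0 = a *: f 0 + g 0 by [].
  by rewrite E f0 g0 scaler0 addr0.
exists (`|a| * M + N) => x y.
rewrite [X in `|X| <= _](_ : _ = a *: (f x - f y) + (g x - g y)); last first.
  by rewrite scalerBr opprD addrACA.
rewrite (le_trans (ler_normD _ _))// mulrDl lerD// normrZ -mulrA.
by rewrite ler_wpM2l.
Qed.

HB.instance Definition _ :=
  GRing.isSubmodClosed.Build _ _ lip0_pred lip0_submod_closed.
HB.instance Definition _ := [SubChoice_isSubLmodule of Lip0 by <:].

Implicit Types f g : Lip0.

Definition lip_quotients f : set R :=
  [set r | exists x y : X, x != y /\ r = `|f x - f y| / `|x - y|].

(* `sup set0 = 0`, so this is the zero norm when `X` is trivial. *)
Definition lip_norm f : R := sup (lip_quotients f).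

Lemma lip0_fun0 f : f 0 = 0.
Proof. by have /lip0_predP[] := lip0_funP f. Qed.

Lemma has_ubound_lip_quotients f : has_ubound (lip_quotients f).
Proof.
have /lip0_predP[_ [M Mf]] := lip0_funP f.
exists M => _ [x [y [xy ->]]].
by rewrite ler_pdivrMr// normr_gt0 subr_eq0.
Qed.

Lemma lip_norm_ge0 f : 0 <= lip_norm f.
Proof.
have [S0|/set0P[r S0]] := eqVneq (lip_quotients f) set0.
  by rewrite /lip_norm S0 sup0.
apply: (@le_trans _ _ r); first by case: S0 => x [y [_ ->]]; rewrite divr_ge0.
by apply: ub_le_sup => //; exact: has_ubound_lip_quotients.
Qed.

Lemma lip_normP f x y : `|f x - f y| <= lip_norm f * `|x - y|.
Proof.
have [->|xy] := eqVneq x y; first by rewrite !subrr !normr0 mulr0.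
rewrite -ler_pdivrMr ?normr_gt0 ?subr_eq0//.
by apply: ub_le_sup; [exact: has_ubound_lip_quotients|exists x, y].
Qed.

Lemma lip_norm_le f (M : R) : 0 <= M ->
  (forall x y, `|f x - f y| <= M * `|x - y|) -> lip_norm f <= M.
Proof.
move=> M0 Mf; have [S0|/set0P S0] := eqVneq (lip_quotients f) set0.
  by rewrite /lip_norm S0 sup0.
apply: ge_sup => // _ [x [y [xy ->]]].
by rewrite ler_pdivrMr// normr_gt0 subr_eq0.
Qed.

Lemma ler_lip_normD f g : lip_norm (f + g) <= lip_norm f + lip_norm g.
Proof.
apply: lip_norm_le => [|x y]; first by rewrite addr_ge0 ?lip_norm_ge0.
rewrite [X in `|X| <= _](_ : _ = (f x - f y) + (g x - g y)); last first.
  by rewrite [LHS]/(f x + g x - (f y + g y)) opprD addrACA.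
by rewrite (le_trans (ler_normD _ _))// mulrDl lerD// lip_normP.
Qed.

Lemma lip_normZ_le (a : R) f : lip_norm (a *: f) <= `|a| * lip_norm f.
Proof.
apply: lip_norm_le => [|x y]; first by rewrite mulr_ge0 ?lip_norm_ge0.
rewrite [X in `|X| <= _](_ : _ = a *: (f x - f y)); last by rewrite scalerBr.
by rewrite normrZ -mulrA ler_wpM2l// lip_normP.
Qed.

Lemma lip_normZ (a : R) f : lip_norm (a *: f) = `|a| * lip_norm f.
Proof.
apply/eqP; rewrite eq_le lip_normZ_le /=.
have [->|a0] := eqVneq a 0; first by rewrite normr0 mul0r lip_norm_ge0.
rewrite -ler_pdivlMl ?normr_gt0// -normfV.
by rewrite -[leLHS](_ : lip_norm (a^-1 *: (a *: f)) = _) ?lip_normZ_le//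
  scalerA mulVf// scale1r.
Qed.

Lemma lip_norm0_eq0 f : lip_norm f = 0 -> f = 0.
Proof.
move=> f0; apply/val_inj/funext => x /=.
have := lip_normP f x 0; rewrite f0 mul0r lip0_fun0 subr0 normr_le0.
by move=> /eqP ->.
Qed.

HB.instance Definition _ := @Lmodule_isNormed.Build R Lip0 lip_norm
  ler_lip_normD lip_normZ lip_norm0_eq0.

Definition LipA : set Lip0 :=
  [set f : Lip0 | exists (x y : nat -> X) (u : Y),
    [/\ forall n, x n != y n,
        `|u| = `|f| &
        (`|x n - y n|^-1 *: (f (x n) - f (y n))) @[n --> \oo] --> u]].

End Lip0.

Section RNP.
Context {R : realType} (Y : normedModType R).

Definition closed_convex_hull (A : set Y) : set Y :=
  smallest [set C : set Y | closed C /\ convex_set C] A.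

Definition dentable (A : set Y) : Prop :=
  forall delta : R, 0 < delta ->
    exists2 a, A a &
      ~ closed_convex_hull (A `\` [set b | `|b - a| < delta]) a.

Definition RNP : Prop :=
  forall A : set Y, A !=set0 -> bounded_set A -> dentable A.

End RNP.

(* Main.v *)
(* The set D of slopes (f x - f y) / |x - y| is bounded and symmetric.  If l is a
  small linear functional such that |y| + l y is maximal over D at a limit y0 of
  points of D, then l y0 >= 0 and g x = f x + (l (f x) / |y0|) y0 is close to f;
  by symmetry every slope of g has norm at most |y0| + l y0, and the slopes of g
  at the maximizing pairs converge to a vector of exactly this norm.

  Such an l is found by nesting slices {psi_n > c_n} of D, psi_n = |.| + l_n, of
  diameter tending to 0 with the increments of l_n summing to little.  If no
  perturbation of size e yields a slice of diameter about d, then by Hahn-Banach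
  each x in D is approximately a convex combination of points of D at distance at
  least d from x, where e times the error is at most the gain in psi_n.  Iterating,
  the barycenters converge to a martingale that is asymptotically close to the
  d-separated original process, so its values form a nondentable set. *)
Require Import Defs.
From mathcomp Require Import all_boot all_order all_algebra.
From mathcomp Require Import all_classical all_reals all_analysis.
From mathcomp Require Import ring lra.
Import Order.TTheory GRing.Theory Num.Theory.
Import numFieldNormedType.Exports.
Local Open Scope classical_set_scope.
Local Open Scope ring_scope.

Set Implicit Arguments.
Unset Strict Implicit.
Unset Printing Implicit Defensive.

(** * Functionals of bounded norm and Hahn-Banach separation *)

Definition bounded_linear {R : realType} {Y : normedModType R} (e : R)
    (l : Y -> R) :=
  [/\ forall x y, l (x + y) = l x + l y,
      forall a x, l (a *: x) = a * l x &
      forall x, `|l x| <= e * `|x|].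

Section separation.
Context {R : realType} {Y : normedModType R}.
Implicit Types (e : R) (K : set (Y * R)).

(** A pair [(v, s)] stands for the constraint [s <= l v] on a functional [l] of norm at most [e]
    that is still to be found. *)
Definition bounded_cone e K :=
  [/\ forall v s w t, K (v, s) -> K (w, t) -> K (v + w, s + t),
      forall a v s, 0 < a -> K (v, s) -> K (a *: v, a * s) &
      forall v s, K (v, s) -> s <= e * `|v|].

Definition cone_adjoin K (v : Y) (s : R) : set (Y * R) :=
  [set p | exists w t a, [/\ K (w, t), 0 <= a & p = (w + a *: v, t + a * s)]].

(** Positive homogeneity reduces the bound for a positive coefficient of [(v, s)] to the coefficient
    1, which is the second hypothesis. *)
Lemma cone_adjoinP e K v s : bounded_cone e K ->
  (forall w t, K (w, t) -> t + s <= e * `|w + v|) ->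
  bounded_cone e (cone_adjoin K v s).
Proof.
move=> [KD KZ Kb] Kvs; split.
- move=> v1 s1 v2 s2 [w1 [t1 [a1 [K1 a1_ge0 [-> ->]]]]].
  move=> [w2 [t2 [a2 [K2 a2_ge0 [-> ->]]]]].
  exists (w1 + w2), (t1 + t2), (a1 + a2); split; [exact: KD|exact: addr_ge0|].
  by rewrite scalerDl mulrDl (addrACA w1) (addrACA t1).
- move=> a _ _ a_gt0 [w [t [b [Kwt b_ge0 [-> ->]]]]].
  exists (a *: w), (a * t), (a * b); split; [exact: KZ| |].
    by rewrite mulr_ge0// ltW.
  by rewrite scalerDr mulrDr scalerA mulrA.
- move=> _ _ [w [t [a [Kwt a_ge0 [-> ->]]]]].
  have [->|a_neq0] := eqVneq a 0; first by rewrite scale0r mul0r !addr0 Kb.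
  have a_gt0 : 0 < a by rewrite lt_neqAle eq_sym a_neq0.
  have ai_gt0 : 0 < a^-1 by rewrite invr_gt0.
  have /(ler_wpM2l a_ge0) := Kvs _ _ (KZ _ _ _ ai_gt0 Kwt).
  rewrite mulrDr mulrA divff// mul1r => /le_trans; apply.
  by rewrite mulrCA -[X in X * `|_|]ger0_norm// -normrZ scalerDr scalerA divff//
    scale1r.
Qed.

(** By maximality, a pair outside the cone is obstructed by some member. If a pair and its opposite
    were both obstructed, the sum of the two obstructing members would violate the bound of the
    cone. *)
Lemma bounded_cone_maximal e K0 : 0 <= e -> bounded_cone e K0 -> K0 (0, 0) ->
  exists K, [/\ bounded_cone e K, K0 `<=` K &
    forall v s, K (v, s) \/ K (- v, - s)].
Proof.
move=> e_ge0 K0cone K00.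
(* The union with [K0] makes the empty chain harmless and puts the maximal cone above [K0]. *)
pose P K := bounded_cone e (K `|` K0).
have [F FP Ftot|K [PK Kmax]] := @Zorn_bigcup _ P.
  have chain p q : (\bigcup_(X in F) X `|` K0) p ->
      (\bigcup_(X in F) X `|` K0) q ->
      exists X, [/\ X `<=` \bigcup_(X in F) X `|` K0, bounded_cone e X, X p &
        X q].
    have sub X : F X -> X `|` K0 `<=` \bigcup_(X in F) X `|` K0.
      by move=> FX r [Xr|]; [left; exists X|right].
    move=> [[X FX Xp]|K0p] [[X' FX' X'q]|K0q].
    - have [XX'|X'X] := Ftot _ _ FX FX'.
        exists (X' `|` K0).
        by split; [exact: sub|exact: FP|left; exact: XX'|left].
      by exists (X `|` K0); split; [exact: sub|exact: FP|left|left; exact: X'X].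
    - by exists (X `|` K0); split; [exact: sub|exact: FP|left|right].
    - by exists (X' `|` K0); split; [exact: sub|exact: FP|right|left].
    - by exists K0; split=> // r; right.
  split.
  - by move=> v s w t /chain /[apply] -[X [XF [XD _ _] Xp Xq]]; exact/XF/XD.
  - move=> a v s a_gt0 Fvs; have [X [XF [_ XZ _] Xp _]] := chain _ _ Fvs Fvs.
    exact/XF/XZ.
  - move=> v s Fvs; have [X [XF [_ _ Xb] Xp _]] := chain _ _ Fvs Fvs.
    exact: Xb.
pose K' := K `|` K0.
have K'0 : K' (0, 0) by right.
have obstruct v s : ~ K' (v, s) ->
    exists w t, K' (w, t) /\ e * `|w + v| < t + s.
  move=> nK'; apply: contrapT => noobs.
  have : bounded_cone e (cone_adjoin K' v s).
    apply: cone_adjoinP => // w t K'wt.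
    by rewrite leNgt; apply/negP => lt; apply: noobs; exists w, t.
  have K'sub : K' `<=` cone_adjoin K' v s.
    move=> [w t] K'wt; exists w, t, 0; split=> //.
    by rewrite scale0r mul0r !addr0.
  have -> : cone_adjoin K' v s = cone_adjoin K' v s `|` K0.
    apply/seteqP; split=> [p|p [//|K0p]]; first by left.
    by apply: K'sub; right.
  apply: Kmax; split; first by move=> p Kp; apply: K'sub; left.
  move=> /(_ (v, s)) sub; apply: nK'; left; apply: sub.
  by exists 0, 0, 1; split=> //; rewrite scale1r mul1r !add0r.
exists K'; split=> //; first by move=> p; right.
move=> v s; have [|/obstruct[w [t [K'wt wt]]]] := pselect (K' (v, s)).
  by left.
right; apply: contrapT => /obstruct[w' [t' [K'wt' wt']]].
have [KD _ Kb] := PK.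
have : t + t' <= e * `|w + w'| by exact/Kb/KD.
apply/negP; rewrite -ltNge.
have -> : w + w' = (w + v) + (w' - v) by rewrite addrACA subrr addr0.
apply: le_lt_trans (ler_wpM2l e_ge0 (ler_normD _ _)) _.
by rewrite mulrDr (lt_le_trans (ltrD wt wt'))// addrACA subrr addr0.
Qed.

(** In a maximal cone [K], let [l v] be the supremum of the [s] with [K (v, s)]. Closure under sums
    and scaling makes [l] superlinear; the dichotomy between a pair and its opposite makes it odd,
    hence linear. *)
Lemma bounded_cone_functional e K0 : 0 <= e -> bounded_cone e K0 -> K0 (0, 0) ->
  exists2 l, bounded_linear e l & forall v s, K0 (v, s) -> s <= l v.
Proof.
move=> e_ge0 K0cone K00.
have [K [[KD KZ Kb] K0K Ktot]] := bounded_cone_maximal e_ge0 K0cone K00.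
pose S v := [set s | K (v, s)].
have S_ub v : ubound (S v) (e * `|v|) by move=> s; exact: Kb.
have S_sup v : has_sup (S v).
  split; last by exists (e * `|v|); exact: S_ub.
  exists (- (e * `|v|) - 1) => /=.
  have [//|/Kb] := Ktot v (- (e * `|v|) - 1).
  by rewrite normrN opprD !opprK; lra.
pose l v := sup (S v).
have Kl v s : K (v, s) -> s <= l v.
  by move=> Kvs; apply: ub_le_sup => //; exact: (S_sup v).2.
have l_le v : l v <= e * `|v| by apply: ge_sup => //; exact: (S_sup v).1.
have KN v s : l v < s -> K (- v, - s).
  by move=> ls; have [/Kl|//] := Ktot v s; lra.
have lD_ge v w : l v + l w <= l (v + w).
  rewrite -lerBrDr; apply: ge_sup; first exact: (S_sup v).1.
  move=> s Ks; rewrite lerBrDr -lerBrDl; apply: ge_sup; first exact: (S_sup w).1.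
  by move=> t Kt; rewrite lerBrDl; apply/Kl/KD.
have l0 : l 0 = 0.
  apply/eqP; rewrite eq_le (le_trans (l_le 0)) ?normr0 ?mulr0//.
  by apply: Kl; exact: K0K.
have lN v : l (- v) = - l v.
  apply/eqP; rewrite eq_le; have := lD_ge v (- v); rewrite subrr l0 => le0.
  apply/andP; split; first lra.
  apply/ler_addgt0Pr => d d_gt0; rewrite lerNl opprD.
  have := Kl _ _ (KN v (l v + d) _); rewrite ltrDl => /(_ d_gt0); lra.
have lD v w : l (v + w) = l v + l w.
  apply/eqP; rewrite eq_le lD_ge andbT.
  by have := lD_ge (- v) (- w); rewrite -opprD !lN; lra.
have lZ_ge a v : 0 < a -> a * l v <= l (a *: v).
  move=> a_gt0; rewrite -ler_pdivlMl//; apply: ge_sup; first exact: (S_sup v).1.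
  by move=> s Ks; rewrite ler_pdivlMl//; apply/Kl/KZ.
have lZ_gt0 a v : 0 < a -> l (a *: v) = a * l v.
  move=> a_gt0; apply/eqP; rewrite eq_le lZ_ge// andbT.
  have := lZ_ge a^-1 (a *: v); rewrite invr_gt0 => /(_ a_gt0).
  by rewrite scalerA mulVf ?gt_eqF// scale1r ler_pdivrMl.
exists l; last by move=> v s K0vs; exact/Kl/K0K.
split=> // [a v|v].
  have [->|a_neq0] := eqVneq a 0; first by rewrite scale0r mul0r.
  have [a_gt0|a_le0] := ltP 0 a; first exact: lZ_gt0.
  have aN_gt0 : 0 < - a by rewrite oppr_gt0 lt_neqAle a_neq0.
  by rewrite -[a *: v]opprK lN -scaleNr lZ_gt0// mulNr opprK.
by rewrite ler_norml lerNl -lN l_le -(normrN v) l_le.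
Qed.

(** Hahn-Banach in Mazur-Orlicz form: the hypothesis says that the cone generated by the pairs
    [(v i, s i)] is bounded. *)
Lemma separation (I : Type) e (v : I -> Y) (s : I -> R) : 0 <= e ->
  (forall c : seq (R * I), all (fun p => 0 <= p.1) c ->
    \sum_(p <- c) p.1 * s p.2 <= e * `|\sum_(p <- c) p.1 *: v p.2|) ->
  exists2 l, bounded_linear e l & forall i, s i <= l (v i).
Proof.
move=> e_ge0 cvs.
pose K0 : set (Y * R) := [set q | exists2 c : seq (R * I),
  all (fun p => 0 <= p.1) c &
  q = (\sum_(p <- c) p.1 *: v p.2, \sum_(p <- c) p.1 * s p.2)].
have [||l lb K0l] := @bounded_cone_functional e K0 e_ge0.
- split.
  + move=> _ _ _ _ [c c0 [-> ->]] [d d0 [-> ->]]; exists (c ++ d).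
      by rewrite all_cat c0.
    by rewrite !big_cat.
  + move=> a _ _ a_gt0 [c c0 [-> ->]]; exists [seq (a * p.1, p.2) | p <- c].
      rewrite all_map; apply: sub_all c0 => p /= p0.
      by rewrite mulr_ge0// ltW.
    rewrite !big_map scaler_sumr mulr_sumr; congr (_, _); apply: eq_bigr => p _.
      by rewrite scalerA.
    by rewrite mulrA.
  + by move=> _ _ [c c0 [-> ->]]; exact: cvs.
- by exists [::] => //; rewrite !big_nil.
exists l => // i; apply: K0l; exists [:: (1, i)]; first by rewrite /= ler01.
by rewrite !big_seq1 scale1r mul1r.
Qed.

End separation.

(** * Sequences with dominated increments *)

Lemma ler_dist_telescope {R : realType} {Y : normedModType R} (u : nat -> Y)
    (b : nat -> R) m n :
  (forall k, `|u k.+1 - u k| <= b k.+1 - b k) -> (m <= n)%N ->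
  `|u n - u m| <= b n - b m.
Proof.
move=> ub /subnK <-; elim: (n - m)%N => [|k IH]; first by rewrite !subrr normr0.
rewrite addSn -(subrKA (u (k + m)%N)).
by apply: (le_trans (ler_normD _ _)); have := ub (k + m)%N; lra.
Qed.

Lemma cauchy_dominated {R : realType} {Y : completeNormedModType R}
    (u : nat -> Y) (b : nat -> R) :
  cvgn b -> (forall n, `|u n.+1 - u n| <= b n.+1 - b n) ->
  exists2 l, u n @[n --> \oo] --> l & forall n, `|l - u n| <= limn b - b n.
Proof.
move=> bcvg /ler_dist_telescope-ub.
have b_nd : {homo b : m n / (m <= n)%N >-> m <= n}.
  by move=> m n mn; rewrite -subr_ge0 (le_trans _ (ub _ _ mn)).
have ucvg : cvgn u.
  apply/cauchy_cvgP/cauchy_exP => d d_gt0.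
  have /cvgrPdist_lt/(_ d d_gt0)[N _ bN] := bcvg.
  exists (u N); exists N => // n /= Nn.
  rewrite -ball_normE /= distrC (le_lt_trans (ub _ _ Nn))//.
  have := bN N (leqnn N); rewrite ger0_norm; last first.
    by rewrite subr_ge0 nondecreasing_cvgn_le.
  by apply: le_lt_trans; rewrite lerD2r nondecreasing_cvgn_le.
exists (limn u) => // n.
apply: (@ler_cvg_to _ \oo _ _ (fun m => `|u m - u n|) (fun m => b m - b n)
  `|limn u - u n| (limn b - b n)).
- exact: (cvg_norm (cvgB ucvg (cvg_cst (u n)))).
- exact: (cvgB bcvg (cvg_cst (b n))).
- by exists n => // m /=; exact: ub.
Qed.

(** * Averaging over a finitely supported Markov kernel *)

Section averages.
Context {R : realType} {Y : normedModType R} {S : Type}.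
Variable st : S -> seq (R * S).
Hypothesis st_ge0 : forall x, all (fun p => 0 <= p.1) (st x).
Hypothesis st_sum1 : forall x, \sum_(p <- st x) p.1 = 1.

(** With [st] as the transition kernel of a Markov chain on [S], the [n]-th iterates of these
    operators are expectations after [n] steps. *)
Definition ravg (u : S -> R) x := \sum_(p <- st x) p.1 * u p.2.
Definition vavg (u : S -> Y) x := \sum_(p <- st x) p.1 *: u p.2.

Lemma ler_ravg u w x : (forall y, u y <= w y) -> ravg u x <= ravg w x.
Proof.
move=> uw; rewrite /ravg; elim: (st x) (st_ge0 x) => [|p c IH] /=.
  by rewrite !big_nil.
by move=> /andP[p0 c0]; rewrite !big_cons lerD ?IH// ler_wpM2l.
Qed.

Lemma ravgD u w x : ravg (fun y => u y + w y) x = ravg u x + ravg w x.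
Proof. by rewrite -big_split; apply: eq_bigr => p _; rewrite mulrDr. Qed.

Lemma ravgM a u x : ravg (fun y => a * u y) x = a * ravg u x.
Proof. by rewrite mulr_sumr; apply: eq_bigr => p _; rewrite mulrCA. Qed.

Lemma ravg_cst a x : ravg (fun=> a) x = a.
Proof. by rewrite /ravg -mulr_suml st_sum1 mul1r. Qed.

Lemma ravgB u w x : ravg (fun y => u y - w y) x = ravg u x - ravg w x.
Proof.
by rewrite ravgD -[in RHS]mulN1r -ravgM; congr (_ + _); apply: eq_bigr => p _;
  rewrite mulN1r.
Qed.

Lemma vavgB_le u w x : `|vavg u x - vavg w x| <= ravg (fun y => `|u y - w y|) x.
Proof.
rewrite /vavg /ravg -sumrB; elim: (st x) (st_ge0 x) => [|p c IH] /=.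
  by rewrite !big_nil normr0.
move=> /andP[p0 c0]; rewrite !big_cons (le_trans (ler_normD _ _))// lerD ?IH//.
by rewrite -scalerBr normrZ ger0_norm.
Qed.

Lemma bounded_linear_vavg e l u x : bounded_linear e l ->
  l (vavg u x) = ravg (l \o u) x.
Proof.
move=> [lD lZ _]; rewrite /vavg /ravg; elim: (st x) => [|p c IH].
  by rewrite !big_nil -(scale0r 0) lZ mul0r.
by rewrite !big_cons lD lZ IH.
Qed.

Lemma cvg_vavg (u : nat -> S -> Y) w x :
  (forall y, u n y @[n --> \oo] --> w y) ->
  vavg (u n) x @[n --> \oo] --> vavg w x.
Proof.
move=> uw; apply: cvg_big; first exact: add_continuous.
by move=> p _; apply: cvgZ; [exact: cvg_cst|exact: uw].
Qed.

(** [S] is a bare type, so the witness is located by a relation [q] that holds for all successors of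
    [x], rather than by membership in [st x]. *)
Lemma ravg_ge_witness (q : S -> S -> bool) u x b :
  all (fun p => q x p.2) (st x) -> b <= ravg u x -> exists2 y, q x y & b <= u y.
Proof.
move=> qx bu; apply: contrapT => noy.
have u_lt y : q x y -> u y < b.
  by move=> qxy; rewrite ltNge; apply/negP => buy; apply: noy; exists y.
suff : ravg u x < (\sum_(p <- st x) p.1) * b.
  by rewrite st_sum1 mul1r ltNge bu.
have : 0 < \sum_(p <- st x) p.1 by rewrite st_sum1.
rewrite /ravg; elim: (st x) (st_ge0 x) qx => [|p c IH] /=.
  by rewrite !big_nil ltxx.
move=> /andP[p0 c0] /andP[qp qc]; rewrite !big_cons mulrDl => sum_gt0.
have p_le : p.1 * u p.2 <= p.1 * b by rewrite ler_wpM2l// ltW// u_lt.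
(* Strictness needs a positive weight: it is that of the head if the tail carries none, and
   otherwise lies in the tail. *)
have [c_le0|c_gt0] := leP (\sum_(p <- c) p.1) 0.
  have p_gt0 : 0 < p.1 by lra.
  apply: ltr_leD; first by rewrite ltr_pM2l// u_lt.
  elim: c c0 qc {IH sum_gt0 c_le0} => [|r c IH] /=.
    by rewrite !big_nil mul0r.
  move=> /andP[r0 c0] /andP[qr qc]; rewrite !big_cons mulrDl lerD ?IH//.
  by rewrite ler_wpM2l// ltW// u_lt.
by apply: ler_ltD => //; exact: IH.
Qed.

Lemma iter_ravg_ge_witness n u x b : b <= iter n ravg u x -> exists y, b <= u y.
Proof.
elim: n x => [|n IH] x /=; first by exists x.
move=> /(@ravg_ge_witness (fun _ _ => true))[|y _ /IH//].
by elim: (st x) => //= p c ->.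
Qed.

End averages.

(** * Convexity, dentability and small slices *)

Lemma weights_ge0 {R : realType} (I : Type) (c : seq (R * I)) :
  all (fun p => 0 <= p.1) c -> 0 <= \sum_(p <- c) p.1.
Proof.
elim: c => [|p c IH] /=; first by rewrite big_nil.
by move=> /andP[p0 c0]; rewrite big_cons addr_ge0 ?IH.
Qed.

Lemma weights_eq0 {R : realType} {V : lmodType R} (I : Type) (v : I -> V)
    (c : seq (R * I)) :
  all (fun p => 0 <= p.1) c -> \sum_(p <- c) p.1 = 0 ->
  \sum_(p <- c) p.1 *: v p.2 = 0.
Proof.
elim: c => [|p c IH] /=; first by rewrite !big_nil.
move=> /andP[p0 c0]; rewrite !big_cons => /eqP.
rewrite paddr_eq0// ?weights_ge0// => /andP[/eqP -> /eqP c_eq0].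
by rewrite scale0r add0r IH.
Qed.

(** Dividing by the total weight lets the induction pass to the tail, whose weights do not sum to
    1. *)
Lemma convex_set_combination {R : realType} {Y : normedModType R} (C : set Y)
    (I : Type) (v : I -> Y) (c : seq (R * I)) :
  @convex_set R Y C -> (forall i, C (v i)) -> all (fun p => 0 <= p.1) c ->
  0 < \sum_(p <- c) p.1 ->
  C ((\sum_(p <- c) p.1)^-1 *: \sum_(p <- c) p.1 *: v p.2).
Proof.
move=> Cconv Cv; elim: c => [|p c IH] /=; first by rewrite !big_nil ltxx.
move=> /andP[p0 c0]; rewrite !big_cons => sum_gt0.
have c_ge0 := weights_ge0 c0; have c_eq0 := weights_eq0 v c0.
set T := \sum_(r <- c) r.1 in IH c_ge0 c_eq0 sum_gt0 *.
set V := \sum_(r <- c) r.1 *: v r.2 in IH c_eq0 *.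
have [T0|T_neq0] := eqVneq T 0.
  move: sum_gt0; rewrite T0 c_eq0// !addr0 => p_gt0.
  by rewrite scalerA mulVf ?gt_eqF// scale1r.
have T_gt0 : 0 < T by rewrite lt_neqAle eq_sym T_neq0.
have t0 : 0 <= p.1 / (p.1 + T) by rewrite divr_ge0// ltW.
have t1 : p.1 / (p.1 + T) <= 1 by rewrite ler_pdivrMr// mul1r lerDl.
have -> : (p.1 + T)^-1 *: (p.1 *: v p.2 + V) =
    (p.1 / (p.1 + T)) *: v p.2 + (1 - p.1 / (p.1 + T)) *: (T^-1 *: V).
  rewrite scalerDr !scalerA; congr (_ *: _ + _ *: _); first by rewrite mulrC.
  by field; rewrite T_neq0 gt_eqF.
have := Cconv (v p.2) (T^-1 *: V) (Itv01 t0 t1).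
by rewrite !inE => /(_ (Cv _) (IH c0 T_gt0)).
Qed.

(** Some ball of radius [r] about [a] misses a closed convex set containing the points of [E] far
    from [a]. So a combination of the vectors [a - y], [y] far, of total weight [T] has norm at
    least [T * r], and separation gives [h]. *)
Lemma dentable_slice {R : realType} {Y : normedModType R} (E : set Y) (d : R) :
  dentable E -> 0 < d ->
  exists a h r, [/\ E a, bounded_linear 1 h, 0 < r &
    forall y, E y -> d <= `|y - a| -> h y <= h a - r].
Proof.
move=> /[apply] -[a Ea].
pose F := E `\` [set b | `|b - a| < d]; rewrite -/F => aF.
have [C [[Ccl Cconv] FC] Ca] : exists2 C, (closed C /\ @convex_set R Y C) /\
    F `<=` C & ~ C a.
  apply: contrapT => noC; apply: aF => C /= [CC FC].
  by apply: contrapT => nCa; apply: noC; exists C.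
have /nbhs_ballP[r /= r_gt0 aC] : nbhs a (~` C).
  by apply: open_nbhs_nbhs; split=> //; exact: closed_openC.
pose I := {y | F y}.
have [c c0|h hb hI] := @separation R Y I 1 (fun i => a - sval i) (fun=> r) ler01.
  rewrite mul1r -mulr_suml; set T := \sum_(p <- c) p.1.
  have [T_le0|T_gt0] := leP T 0.
    by rewrite (le_trans _ (normr_ge0 _))// mulr_le0_ge0// ltW.
  set V := \sum_(p <- c) p.1 *: sval p.2.
  have CV : C (T^-1 *: V).
    by apply: convex_set_combination => // -[y Fy]; exact: FC.
  have -> : \sum_(p <- c) p.1 *: (a - sval p.2) = T *: (a - T^-1 *: V).
    rewrite scalerBr scalerA divff ?gt_eqF// scale1r scaler_suml -sumrB.
    by apply: eq_bigr => p _; rewrite scalerBr.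
  rewrite normrZ gtr0_norm// ler_pM2l// leNgt; apply/negP => lt_r.
  by apply: (aC (T^-1 *: V)) => //; rewrite -ball_normE.
exists a, h, r; split=> // y Ey day; have [hD hZ _] := hb.
have Fy : F y by split=> //=; apply/negP; rewrite -leNgt.
have := hI (exist _ y Fy); rewrite /= hD -scaleN1r hZ; lra.
Qed.

(* A process that drifts by at most [1/e] times its expected gain in the bounded
  function [phi] stays within finite distance of the martingale [z] of its
  limits; the values of [z] form a nondentable set. *)
Lemma RNP_no_gain_process {R : realType} {Y : completeNormedModType R}
    {S : Type} (pos : S -> Y) (phi : S -> R) (st : S -> seq (R * S))
    (e d M : R) :
  RNP Y -> 0 < e -> 0 < d ->
  (forall x, `|pos x| <= M) -> (forall x, `|phi x| <= M) ->
  (forall x, all (fun p => 0 <= p.1) (st x)) ->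
  (forall x, \sum_(p <- st x) p.1 = 1) ->
  (forall x, all (fun p => d <= `|pos p.2 - pos x|) (st x)) ->
  (forall x, e * `|vavg st pos x - pos x| <= ravg st phi x - phi x) ->
  S -> False.
Proof.
move=> YRNP e_gt0 d_gt0 posM phiM st0 st1 stfar gain x0.
(* [f n x] and [w n x] are the expected values of [phi] and of the position [n] steps after [x]. *)
pose P := ravg st; pose f n := iter n P phi.
pose w n := iter n (vavg st) pos.
have f_le n x : f n x <= M.
  elim: n x => [|n IH] x /=; first by rewrite (le_trans (ler_norm _)).
  by rewrite -[leRHS](ravg_cst st1 M x); exact: ler_ravg.
have w_gain n x : `|w n.+1 x - w n x| <= e^-1 * f n.+1 x - e^-1 * f n x.
  elim: n x => [|n IH] x; first by rewrite -mulrBr ler_pdivlMl// gain.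
  rewrite (le_trans (vavgB_le st0 _ _ _))//.
  rewrite -!ravgM -ravgB; apply: ler_ravg => // y; exact: IH.
have f_nd x : {homo f^~ x : m n / (m <= n)%N >-> m <= n}.
  move=> m n mn; have := ler_dist_telescope (w_gain^~ x) mn.
  move=> /(le_trans (normr_ge0 _)).
  by rewrite -mulrBr pmulr_rge0 ?invr_gt0// subr_ge0.
have f_cvg x : cvgn (f^~ x).
  by apply: nondecreasing_is_cvgn => //; exists M => _ [n _ <-].
pose g x := limn (f^~ x).
have f_g x n : f n x <= g x by exact: nondecreasing_cvgn_le.
have g_le x : g x <= M by apply: limr_le => //; exact: nearW.
have ef_cvg x : e^-1 * f n x @[n --> \oo] --> e^-1 * g x.
  exact: cvgMl_tmp.
have /choice[z zP] x : exists l, w n x @[n --> \oo] --> l /\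
    `|l - pos x| <= e^-1 * (g x - phi x).
  have efc : cvgn (fun n => e^-1 * f n x) by apply/cvg_ex; exists (e^-1 * g x).
  have [l wl l_le] := cauchy_dominated efc (w_gain^~ x).
  exists l; split=> //; have := l_le 0%N.
  by rewrite (cvg_lim _ (ef_cvg x))// mulrBr.
have wz x : w n x @[n --> \oo] --> z x by have [] := zP x.
have z_le x : `|z x - pos x| <= e^-1 * (g x - phi x) by have [] := zP x.
(* The limits [z] and [g] are harmonic for the kernel: along the process they are martingales. *)
have zavg x : vavg st z x = z x.
  have w_avg : vavg st (w n) x @[n --> \oo] --> vavg st z x by exact: cvg_vavg.
  by apply: (cvg_unique _ w_avg); have := wz x; rewrite -cvg_shiftS.
have gavg x : P g x = g x.
  have f_avg : P (f n) x @[n --> \oo] --> P g x.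
    by apply: (@cvg_vavg _ R^o); exact: f_cvg.
  by apply: (cvg_unique _ f_avg); have := f_cvg x; rewrite -cvg_shiftS.
pose E := range z.
have E0 : E !=set0 by exists (z x0), x0.
have Ebnd : bounded_set E.
  exists (M + e^-1 * (M + M)); split; first exact: num_real.
  move=> N MN _ [x _ <-].
  rewrite /= -(subrK (pos x) (z x)) addrC.
  rewrite (le_trans (ler_normD _ _))// ltW// (le_lt_trans _ MN)// lerD//.
  rewrite (le_trans (z_le x))// ler_pM2l ?invr_gt0// lerD//.
  by have := phiM x; rewrite ler_norml => /andP[]; lra.
have d4_gt0 : 0 < d / 4 by rewrite divr_gt0.
have [a [h [r [[x1 _ zx1] hb r_gt0 hr]]]] :=
  dentable_slice (YRNP _ E0 Ebnd) d4_gt0.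
have h_le u v : h u <= h v + `|u - v|.
  have [hD _ h1] := hb.
  have := le_trans (ler_norm _) (h1 (u - v)); rewrite mul1r.
  by have := hD (u - v) v; rewrite subrK; lra.
(* [v] weighs the depth of [z x] in the slice of [h] against the expected gain still to come. Where
   [v x] is positive, [K * (g x - phi x)] is below [d / 4 + r]; this [K] turns that into a distance
   of at most [d / 8] from [z x] to [pos x]. *)
pose K := (d / 4 + r) / (e * (d / 8)).
have K_gt0 : 0 < K by rewrite divr_gt0 ?addr_gt0 ?mulr_gt0 ?divr_gt0.
pose v x := h (z x) - (h a - r) - K * (g x - phi x).
have slice x : 0 < v x -> `|z x - a| < d / 4 /\ `|z x - pos x| <= d / 8.
  move=> vx; have gphi : 0 <= K * (g x - phi x).
    by rewrite (mulr_ge0 (ltW K_gt0))// subr_ge0 (f_g x 0%N).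
  have za : `|z x - a| < d / 4.
    rewrite ltNge; apply/negP => /hr; have /[swap]/[apply] : E (z x) by exists x.
    by move: vx; rewrite /v; lra.
  split=> //; rewrite (le_trans (z_le x))// ler_pdivrMl//.
  rewrite -(ler_pM2l K_gt0) {2}/K mulfVK ?gt_eqF ?mulr_gt0 ?divr_gt0//.
  by have := h_le (z x) a; move: vx; rewrite /v; lra.
(* As [z] and [g] are harmonic, averaging [v] only replaces [phi] by [f n]; at [x1] the result tends
   to [r]. *)
have iter_v n x : iter n P v x = h (z x) - (h a - r) - K * (g x - f n x).
  elim: n x => [//|n IH] x; rewrite /= -/P.
  have -> : P (iter n P v) x =
      P (fun y => (h (z y) - (h a - r)) - (K * g y - K * f n y)) x.
    by congr (P _ x); apply/funext => y; rewrite IH mulrBr.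
  rewrite {1}/P !ravgB !ravgM !ravg_cst// -(bounded_linear_vavg st z x hb) zavg.
  by rewrite -/P gavg mulrBr.
have v_le x : v x <= P v x.
  have := iter_v 1%N x; rewrite /= => ->; rewrite lerD2l lerN2 ler_pM2l// lerD2l.
  by rewrite lerN2 (f_nd x 0%N 1%N).
have vx1 : K * (g x1 - f n x1) @[n --> \oo] --> 0.
  rewrite -(mulr0 K) -(subrr (g x1)); apply: cvgMl_tmp.
  by apply: cvgB; [exact: cvg_cst|exact: f_cvg].
have r2_gt0 : 0 < r / 2 by rewrite divr_gt0.
have /cvgrPdist_lt/(_ _ r2_gt0)[n _ /(_ n (leqnn n))/=] := vx1.
rewrite sub0r normrN => /ltr_normlW n_lt.
have [x vx] : exists x, r / 2 <= v x.
  apply: (iter_ravg_ge_witness st0 st1 (n := n) (x := x1)).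
  by rewrite -/P iter_v zx1; lra.
(* As [v] is at most its average, some successor [y] of [x] also has [v y >= r / 2]. Then [pos x]
   and [pos y] are within [d/8 + d/4 + d/4 + d/8 < d], against the separation of successors. *)
have [y xy vy] := @ravg_ge_witness _ _ _ st0 st1
  (fun x y => d <= `|pos y - pos x|) _ _ _ (stfar x) (le_trans vx (v_le x)).
have [zxa zx] := slice x (lt_le_trans r2_gt0 vx).
have [zya zy] := slice y (lt_le_trans r2_gt0 vy).
move: xy; rewrite leNgt => /negP; apply.
have := ler_distD (z y) (pos y) (pos x); have := ler_distD a (z y) (pos x).
have := ler_distD (z x) a (pos x).
by rewrite (distrC (pos y) (z y)) (distrC a (z x)); lra.
Qed.

(** If no such [l] exists, separation fails at every [x] in [D]. The violating combinations,
    normalised, are the transitions of a process excluded by [RNP_no_gain_process]. The first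
    alternative covers the case where the slice above the value at [x] is empty. *)
Lemma small_slice {R : realType} {Y : completeNormedModType R} (D : set Y)
    (psi : Y -> R) (e d M : R) :
  RNP Y -> 0 < e -> 0 < d -> D !=set0 ->
  (forall y, D y -> `|y| <= M) -> (forall y, D y -> `|psi y| <= M) ->
  exists2 l, bounded_linear e l &
    (exists2 x, D x & forall y, D y -> psi y + l y <= psi x + l x) \/
    (exists c x x', [/\ D x', c < psi x' + l x' &
      forall y, D y -> c < psi y + l y -> `|y - x| < d]).
Proof.
move=> YRNP e_gt0 d_gt0 [y0 Dy0] DM psiM; apply: contrapT => noslice.
pose S := {x | D x}; pose far (x : S) := {y : S | d <= `|sval y - sval x|}.
have step (x : S) : exists c : seq (R * S), [/\ all (fun p => 0 <= p.1) c,
    \sum_(p <- c) p.1 = 1,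
    all (fun p => d <= `|sval p.2 - sval x|) c &
    e * `|\sum_(p <- c) p.1 *: sval p.2 - sval x| <=
    \sum_(p <- c) p.1 * psi (sval p.2) - psi (sval x)].
  pose v (y : far x) := sval (sval y) - sval x.
  pose s (y : far x) := psi (sval (sval y)) - psi (sval x).
  have [c c0 cvs] : exists2 c : seq (R * far x), all (fun p => 0 <= p.1) c &
      e * `|\sum_(p <- c) p.1 *: v p.2| < \sum_(p <- c) p.1 * s p.2.
    apply: contrapT => noc.
    have [c c0|l [lD lZ lb] ls] := @separation R Y (far x) e v s (ltW e_gt0).
      by rewrite leNgt; apply/negP => lt; apply: noc; exists c.
    have lN y : l (- y) = - l y by rewrite -scaleN1r lZ mulN1r.
    (* Separation bounds [psi - l] at points far from [x] by its value at [x], so the slice above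
       that value lies near [x]. *)
    apply: noslice; exists (fun y => - l y).
      split=> [y y'|a y|y]; first by rewrite lD opprD.
        by rewrite lZ mulrN.
      by rewrite normrN.
    have [xmax|nxmax] := pselect
        (forall y, D y -> psi y - l y <= psi (sval x) - l (sval x)).
      by left; exists (sval x) => //; exact: (svalP x).
    right; exists (psi (sval x) - l (sval x)), (sval x).
    have [x' [Dx' x'x]] : exists x', D x' /\
        psi (sval x) - l (sval x) < psi x' - l x'.
      apply: contrapT => nox'; apply: nxmax => y Dy.
      by rewrite leNgt; apply/negP => lt; apply: nox'; exists y.
    exists x'; split=> // y Dy; apply: contraTT; rewrite -!leNgt => dy.
    have := ls (exist _ (exist _ y Dy) dy); rewrite /s /v /= lD lN; lra.
  have c_gt0 : 0 < \sum_(p <- c) p.1.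
    (* With total weight 0 all weights would vanish, contradicting the strict inequality [cvs]. *)
    rewrite lt_neqAle weights_ge0// andbT eq_sym; apply/eqP => T0.
    have := weights_eq0 (s : far x -> R^o) c0 T0.
    have : 0 < \sum_(p <- c) p.1 * s p.2.
      by rewrite (le_lt_trans _ cvs)// mulr_ge0// ltW.
    by rewrite /GRing.scale /= => /lt0r_neq0/eqP.
  set T := \sum_(p <- c) p.1 in c_gt0.
  exists [seq (T^-1 * p.1, sval p.2) | p <- c]; split.
  - rewrite all_map; apply: sub_all c0 => p /= p0.
    by rewrite mulr_ge0// invr_ge0 ltW.
  - by rewrite big_map -mulr_sumr mulVf// gt_eqF.
  - rewrite all_map; elim: (c) => //= p c' ->; rewrite andbT.
    exact: (svalP p.2).
  - rewrite !big_map /=.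
    have -> : \sum_(p <- c) (T^-1 * p.1) *: sval (sval p.2) - sval x =
        T^-1 *: \sum_(p <- c) p.1 *: v p.2.
      under [in RHS]eq_bigr do rewrite scalerBr.
      rewrite sumrB -scaler_suml scalerBr scalerA mulVf ?gt_eqF// scale1r.
      by rewrite scaler_sumr; under [in RHS]eq_bigr do rewrite scalerA.
    have -> : \sum_(p <- c) T^-1 * p.1 * psi (sval (sval p.2)) - psi (sval x) =
        T^-1 * \sum_(p <- c) p.1 * s p.2.
      under [in RHS]eq_bigr do rewrite mulrBr.
      rewrite sumrB -mulr_suml mulrBr mulrA mulVf ?gt_eqF// mul1r.
      by rewrite mulr_sumr; under [in RHS]eq_bigr do rewrite mulrA.
    by rewrite normrZ gtr0_norm ?invr_gt0// mulrCA ler_pM2l ?invr_gt0// ltW.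
have [st stP] := choice step.
apply: (@RNP_no_gain_process R Y S sval (psi \o sval) st e d M) => //.
- by move=> x; exact/DM/(svalP x).
- by move=> x; exact/psiM/(svalP x).
- by move=> x; case: (stP x).
- by move=> x; case: (stP x).
- by move=> x; case: (stP x).
- by move=> x; case: (stP x).
- by exists y0.
Qed.

(** * Calculus of bounded functionals and the variational principle *)

Section bounded_linear.
Context {R : realType} {Y : normedModType R}.
Implicit Types (l : Y -> R) (e : R).

Lemma bounded_linearB l e x y : bounded_linear e l -> l (x - y) = l x - l y.
Proof. by move=> [lD lZ _]; rewrite lD -scaleN1r lZ mulN1r. Qed.

Lemma bounded_linear_sum l1 l2 e1 e2 : bounded_linear e1 l1 ->
  bounded_linear e2 l2 -> bounded_linear (e1 + e2) (fun y => l1 y + l2 y).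
Proof.
move=> [D1 Z1 b1] [D2 Z2 b2]; split=> [x y|a x|x].
- by rewrite D1 D2 addrACA.
- by rewrite Z1 Z2 mulrDr.
- by rewrite (le_trans (ler_normD _ _))// mulrDl lerD.
Qed.

Lemma bounded_linear_le l e1 e2 : e1 <= e2 -> bounded_linear e1 l ->
  bounded_linear e2 l.
Proof.
by move=> e12 [D1 Z1 b1]; split=> // x; rewrite (le_trans (b1 x))// ler_wpM2r.
Qed.

Lemma bounded_linear_cvg l e (u : nat -> Y) y : bounded_linear e l ->
  u n @[n --> \oo] --> y -> l (u n) @[n --> \oo] --> l y.
Proof.
move=> lb uy; apply/cvgrPdist_le => d d_gt0 /=.
have e1_gt0 : 0 < `|e| + 1 by rewrite ltr_wpDl.
have de_gt0 : 0 < d / (`|e| + 1) by rewrite divr_gt0.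
have /cvgrPdist_le/(_ _ de_gt0)[N _ uN] := uy.
exists N => // n /uN {}uN; rewrite -(bounded_linearB _ _ lb).
have [_ _ /(_ (y - u n))/le_trans -> //] := lb.
apply: (@le_trans _ _ ((`|e| + 1) * `|y - u n|)).
  by rewrite ler_wpM2r// (le_trans (ler_norm e))// lerDl.
by rewrite -ler_pdivlMl// mulrC.
Qed.

Lemma bounded_linear_lim (L : nat -> Y -> R) l e :
  (forall n, bounded_linear e (L n)) ->
  (forall y, L n y @[n --> \oo] --> l y) -> bounded_linear e l.
Proof.
move=> Lb Ll; split=> [x y|a x|x].
- have LD : (fun n => L n (x + y)) = (fun n => L n x + L n y).
    by apply/funext => n; have [-> _ _] := Lb n.
  have Lxy := Ll (x + y); rewrite LD in Lxy.
  by apply: (cvg_unique _ Lxy) => //; apply: cvgD.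
- have LZ : (fun n => L n (a *: x)) = (fun n => a * L n x).
    by apply/funext => n; have [_ -> _] := Lb n.
  have Lax := Ll (a *: x); rewrite LZ in Lax.
  by apply: (cvg_unique _ Lax) => //; apply: cvgMl_tmp.
- apply: (cvgr_to_le (cvg_norm (Ll x))).
  by apply: nearW => n; have [_ _ ->] := Lb n.
Qed.

End bounded_linear.

(* Stegall's variational principle; [D] need not be closed, so the maximum is
  attained at a limit of points of [D]. *)
Lemma perturbed_maximum {R : realType} {Y : completeNormedModType R}
    (D : set Y) (psi : Y -> R) (e M : R) :
  RNP Y -> 0 < e -> D !=set0 -> continuous psi ->
  (forall y, D y -> `|y| <= M) -> (forall y, D y -> `|psi y| <= M) ->
  exists l u y0, [/\ bounded_linear e l, forall n, D (u n),
    u n @[n --> \oo] --> y0 &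
    forall y, D y -> psi y + l y <= psi y0 + l y0].
Proof.
move=> YRNP e_gt0 [y1 Dy1] psic DM psiM; apply: contrapT => nomax.
have nomaxD l : bounded_linear e l ->
    ~ exists2 x, D x & forall y, D y -> psi y + l y <= psi x + l x.
  move=> lb [x Dx xmax]; apply: nomax; exists l, (fun=> x), x; split=> //.
  exact: cvg_cst.
have M_ge0 : 0 <= M by rewrite (le_trans _ (DM _ Dy1)).
pose q n : R := 2^-1 ^+ n.
have q_gt0 n : 0 < q n by rewrite exprn_gt0// invr_gt0.
have q_le1 n : q n <= 1.
  by rewrite exprn_ile1 ?invr_ge0// invf_le1// ler1n.
have qS n : q n = q n.+1 + q n.+1 by rewrite /q exprS; lra.
(* A state holds a step number, the perturbation so far, the level of the current slice and a point
   of that slice. The norm spent after [n] steps is at most [e * (1 - q n)], so the total stays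
   within [e]. *)
pose State := (nat * ((Y -> R) * (R * Y)))%type.
pose idx (s : State) := s.1; pose fn (s : State) := s.2.1.
pose lv (s : State) := s.2.2.1; pose pt (s : State) := s.2.2.2.
pose inv s := [/\ bounded_linear (e * (1 - q (idx s))) (fn s), D (pt s) &
  lv s < psi (pt s) + fn s (pt s)].
pose next s s' := [/\ idx s' = (idx s).+1,
  forall y, `|fn s' y - fn s y| <= e * q (idx s') * `|y| &
  forall y, D y -> lv s' < psi y + fn s' y ->
    lv s < psi y + fn s y /\ `|y - pt s'| <= q (idx s')].
have step s : inv s -> exists2 s', inv s' & next s s'.
  case: s => n [l [c x]] [/= lb Dx cx].
  pose gap := psi x + l x - c.
  have gapE : psi x + l x = c + gap by rewrite /gap; ring.
  have gap_gt0 : 0 < gap by rewrite subr_gt0.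
  (* The second bound keeps the new functional below [gap / 4] in absolute value on [D]: slices
     above [c + gap / 2] stay inside the old one, and [x] stays in the slice at exactly that level.
     The [+ 1] guards against [M = 0]. *)
  pose t := Num.min (e * q n.+1) (gap / (4 * (M + 1))).
  have t_gt0 : 0 < t.
    by rewrite lt_min mulr_gt0//= divr_gt0// mulr_gt0// ltr_wpDl.
  have tM y : D y -> t * `|y| <= gap / 4.
    move=> /DM yM; apply: (@le_trans _ _ (gap / (4 * (M + 1)) * (M + 1))).
      by apply: ler_pM; [exact: ltW|by []|rewrite ge_min lexx orbT|lra].
    by rewrite invfM mulrA divfK// gt_eqF// ltr_wpDl.
  have t_le : t <= e * q n.+1 by rewrite ge_min lexx.
  have lM y : D y -> `|psi y + l y| <= M + e * M.
    move=> Dy; rewrite (le_trans (ler_normD _ _))// lerD ?psiM//.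
    have [_ _ /(_ y)/le_trans -> //] := lb.
    rewrite ler_pM ?DM//; last by rewrite (ler_piMr (ltW e_gt0))// gerBl ltW.
    by rewrite (mulr_ge0 (ltW e_gt0))// subr_ge0.
  have M_le y : D y -> `|y| <= M + e * M.
    by move=> /DM yM; rewrite (le_trans yM)// lerDl mulr_ge0// ltW.
  (* Radius [q n.+2] about the centre [x1] gives [q n.+1] about the chosen point of the slice. *)
  have [//|g gb slice] := small_slice YRNP t_gt0 (q_gt0 n.+2) _ M_le lM.
    by exists x.
  have lgb : bounded_linear (e * (1 - q n.+1)) (fun y => l y + g y).
    apply: bounded_linear_le (bounded_linear_sum lb gb).
    rewrite (le_trans (lerD (lexx _) t_le))// -mulrDr ler_pM2l//.
    by rewrite (qS n); lra.
  have {slice}[[x' Dx' x'max]|[c1 [x1 [x2 [Dx2 c1x2 slice]]]]] := slice.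
    exfalso; apply: (nomaxD (fun y => l y + g y)).
      apply: bounded_linear_le lgb.
      by rewrite (ler_piMr (ltW e_gt0))// gerBl ltW.
    by exists x' => // y /x'max; rewrite !addrA.
  pose c' := Num.max c1 (c + gap / 2).
  have g_le y : D y -> `|g y| <= gap / 4.
    by move=> Dy; have [_ _ /(_ y)/le_trans -> //] := gb; exact: tM.
  have [x' Dx' c'x'] : exists2 x', D x' & c' < psi x' + (l x' + g x').
    have [c1c|cc1] := leP c1 (c + gap / 2).
      exists x => //; rewrite /c' max_r//.
      by have := g_le x Dx; rewrite ler_norml => /andP[]; lra.
    by exists x2 => //; rewrite /c' max_l ?ltW// addrA.
  exists (n.+1, (fun y => l y + g y, (c', x'))); first by split.
  have inball y : D y -> c' < psi y + (l y + g y) -> `|y - x1| < q n.+2.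
    move=> Dy; rewrite addrA gt_max => /andP[c1y _]; exact: slice.
  rewrite /next /idx /fn /lv /pt /=; split=> //= [y|y Dy c'y].
    rewrite addrC addKr; have [_ _ /(_ y)/le_trans -> //] := gb.
    by rewrite ler_wpM2r.
  split.
    move: c'y; rewrite gt_max => /andP[_ ].
    by have := g_le y Dy; rewrite ler_norml => /andP[]; lra.
  have := inball _ Dy c'y; have := inball _ Dx' c'x'.
  by have := ler_distD x1 y x'; rewrite (distrC x1) (qS n.+1); lra.
have Mlow : - M - 1 < psi y1 + 0.
  by have := psiM _ Dy1; rewrite ler_norml => /andP[]; lra.
have inv0 : inv (0%N, (fun=> 0, (- M - 1, y1))).
  split=> //; rewrite /= /q expr0 subrr mulr0; split=> [x y|a x|x].
  - by rewrite addr0.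
  - by rewrite mulr0.
  - by rewrite normr0 mul0r.
have [|F [F0 FS]] := @dependent_choice {s | inv s}
    (fun s s' => next (sval s) (sval s')) _ (exist _ _ inv0).
  move=> [s invs]; apply: cid; have [s' invs' ss'] := step s invs.
  by exists (exist _ s' invs').
have Fidx n : idx (sval (F n)) = n.
  by elim: n => [|n IH]; [rewrite F0|have [-> _ _] := FS n; rewrite IH].
pose L n := fn (sval (F n)); pose x n := pt (sval (F n)).
pose c n := lv (sval (F n)).
have Lb n : bounded_linear (e * (1 - q n)) (L n).
  by have := svalP (F n); rewrite /inv Fidx => -[].
have Dx n : D (x n) by have [] := svalP (F n).
have cx n : c n < psi (x n) + L n (x n) by have [] := svalP (F n).
have LS n y : `|L n.+1 y - L n y| <= e * q n.+1 * `|y|.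
  by have [_ + _] := FS n; rewrite Fidx => /(_ y).
have slS n y : D y -> c n.+1 < psi y + L n.+1 y ->
    c n < psi y + L n y /\ `|y - x n.+1| <= q n.+1.
  by have [_ _] := FS n; rewrite Fidx => /(_ y).
have q_cvg0 : q n @[n --> \oo] --> 0.
  by apply: cvg_expr; rewrite ger0_norm ?invr_ge0// invf_lt1// ltr1n.
have Llim y : exists2 ly, L n y @[n --> \oo] --> ly &
    forall n, `|ly - L n y| <= e * `|y| * q n.
  pose b n := - (e * `|y| * q n).
  have b0 : b n @[n --> \oo] --> 0.
    rewrite -oppr0 -(mulr0 (e * `|y|)); apply: cvgN; exact: cvgMl_tmp.
  have [||ly Lly bl] := @cauchy_dominated R R^o (fun n => L n y) b.
  - by apply/cvg_ex; exists 0.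
  - by move=> n; rewrite (le_trans (LS n y))// /b (qS n); lra.
  by exists ly => // n; have := bl n; rewrite (cvg_lim _ b0)// sub0r opprK.
have /choice[l Ll] y : exists ly : R, L n y @[n --> \oo] --> ly.
  by have [ly] := Llim y; exists ly.
have Lbe n : bounded_linear e (L n).
  by apply: bounded_linear_le (Lb n); rewrite (ler_piMr (ltW e_gt0))// gerBl ltW.
have lb : bounded_linear e l := bounded_linear_lim Lbe Ll.
have [y0 xy0] : exists y0 : Y, x n @[n --> \oo] --> y0.
  have b0 : - (2 * q n.+1) @[n --> \oo] --> (0 : R).
    rewrite -oppr0 -(mulr0 2); apply: cvgN; apply: cvgMl_tmp.
    by rewrite (cvg_shiftS q).
  (* The shift by one is due to slice 0, whose size is not controlled. *)
  have [||y0 + _] := @cauchy_dominated R Y (fun n => x n.+1)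
    (fun n => - (2 * q n.+1)).
  - by apply/cvg_ex; exists 0.
  - move=> n; have [cx1 _] := slS _ _ (Dx n.+2) (cx n.+2).
    by have [_] := slS _ _ (Dx n.+2) cx1; rewrite (qS n.+1); lra.
  by rewrite (cvg_shiftS x); exists y0.
apply: nomax; exists l, x, y0; split=> // y Dy.
(* A point of all slices is the limit [y0]. Any other point stays outside from some step on, so its
   value is at most the level, hence below the value at [x n]; then pass to the limit. *)
have [yin|yout] := pselect (forall n, c n < psi y + L n y).
  suff -> : y = y0 by [].
  apply/esym; apply: (cvg_unique _ xy0) => //=; rewrite -(cvg_shiftS x).
  apply/cvgrPdist_le => d d_gt0.
  move: q_cvg0; rewrite -cvg_shiftS => /cvgrPdist_le/(_ _ d_gt0)[N _ qN].
  exists N => // n /qN; rewrite /= sub0r normrN gtr0_norm// => /(le_trans _).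
  by apply; have [] := slS _ _ Dy (yin n.+1).
have [N yN] : exists N, psi y + L N y <= c N.
  apply: contrapT => noN; apply: yout => n.
  by rewrite ltNge; apply/negP => le; apply: noN; exists n.
have yNn n : (N <= n)%N -> psi y + L n y <= c n.
  move=> /subnK <-; elim: (n - N)%N => [//|k IH].
  by rewrite leNgt; apply/negP => /(slS _ _ Dy)[]; rewrite ltNge IH.
(* Pointwise convergence of [L n] suffices because the norms are uniformly bounded by [e]. *)
have Lx : L n (x n) @[n --> \oo] --> l y0.
  have -> : (fun n => L n (x n)) = (fun n => L n (x n - y0) + L n y0).
    by apply/funext => n; rewrite (bounded_linearB _ _ (Lb n)) subrK.
  rewrite -[l y0]add0r; apply: cvgD => //; apply/norm_cvg0P.
  apply: (@squeeze_cvgr _ _ _ _ (fun=> 0) (fun n => e * `|x n - y0|)).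
  - by apply: nearW => n; rewrite normr_ge0; have [_ _ ->] := Lbe n.
  - exact: cvg_cst.
  - rewrite -(mulr0 e); apply: cvgMl_tmp; rewrite -(@normr0 _ Y) -(subrr y0).
    by apply: cvg_norm; apply: cvgB => //; exact: cvg_cst.
apply: (@ler_cvg_to _ \oo _ _ (fun n => psi y + L n y)
  (fun n => psi (x n) + L n (x n))).
- by apply: cvgD => //; exact: cvg_cst.
- by apply: cvgD => //; apply: continuous_cvg => //; exact: psic.
- by exists N => // n /= /yNn /le_trans; apply; rewrite ltW.
Qed.

(** * Density of the maps attaining their norm asymptotically *)

Unset Implicit Arguments.

Theorem corollary3p13 (R : realType) (X Y : completeNormedModType R)
    (X_neq0 : exists x : X, x != 0) (Y_RNP : RNP Y) :
  dense (@LipA R X Y).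
Proof.
move=> O [f Of] Oopen.
have /nbhs_ballP[r /= r_gt0 fO] : nbhs f O by exact: open_nbhs_nbhs.
pose M := lip_norm f; have M_ge0 : 0 <= M := lip_norm_ge0 f.
pose slope (h : X -> Y) (p q : X) : Y := `|p - q|^-1 *: (h p - h q).
pose D := [set y | exists p q, p != q /\ y = slope f p q].
have DN y : D y -> D (- y).
  move=> [p [q [pq ->]]]; exists q, p; split; first by rewrite eq_sym.
  by rewrite /slope -scalerN opprB distrC.
have D0 : D !=set0.
  by have [x x0] := X_neq0; exists (slope f x 0), x, 0.
have DM y : D y -> `|y| <= M.
  move=> [p [q [pq ->]]]; rewrite /slope normrZ normfV normr_id.
  by rewrite ler_pdivrMl ?normr_gt0 ?subr_eq0// mulrC lip_normP.
have [e e_gt0 eM_lt] : exists2 e, 0 < e & e * M < r.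
  have M1_gt0 : 0 < M + 1 by rewrite ltr_wpDl.
  exists (r / (M + 1)); first exact: divr_gt0.
  by rewrite mulrAC ltr_pdivrMr// ltr_pM2l// ltrDl.
have [|l [u [y0 [lb Du uy0 y0max]]]] := perturbed_maximum Y_RNP e_gt0 D0
  (@norm_continuous R Y) DM (M := M).
  by move=> y /DM; rewrite normr_id.
have [lD lZ le] := lb.
(* If [y0 = 0] then [w = 0], the inverse of 0 being 0; hence only [w_le1]. *)
pose w := `|y0|^-1 *: y0.
have w_le1 : `|w| <= 1.
  rewrite /w normrZ normfV normr_id.
  by have [->|y00] := eqVneq y0 0; rewrite ?normr0 ?mulr0// mulVf// normr_eq0.
have lN y : l (- y) = - l y by rewrite -scaleN1r lZ mulN1r.
have ly0_ge0 : 0 <= l y0.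
  have : `|y0| - l y0 <= `|y0| + l y0; last lra.
  have lu := bounded_linear_cvg lb uy0.
  apply: (cvgr_to_le (cvgB (cvg_norm uy0) lu)); apply: nearW => n.
  by have := y0max _ (DN _ (Du n)); rewrite normrN lN.
have ly_le y : D y -> `|y| + `|l y| <= `|y0| + l y0.
  move=> Dy; have [_|_] := ger0P (l y); first exact: y0max.
  by have := y0max _ (DN _ Dy); rewrite normrN lN.
(* A rank-one perturbation of the identity: composing with [T] applies [T] to every slope. It sends
   [y0] to a vector of norm [|y0| + l y0], which bounds the norms of all slopes of [T \o f]. *)
pose T y := y + l y *: w.
have TB y y' : T y - T y' = T (y - y').
  by rewrite /T (bounded_linearB _ _ lb) scalerBl opprD addrACA.
have TK y : T y - y = l y *: w by rewrite /T addrAC subrr add0r.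
have TZ a y : T (a *: y) = a *: T y by rewrite /T lZ -scalerA scalerDr.
have T_le y : `|T y| <= `|y| + `|l y|.
  rewrite (le_trans (ler_normD _ _))// lerD2l normrZ ler_piMr//.
have Tslope p q : slope (T \o f) p q = T (slope f p q) by rewrite /slope TB TZ.
have gP : (T \o f) \in @lip0_pred R X Y.
  apply/lip0_predP; split.
    by rewrite /= lip0_fun0 /T -(scale0r 0) lZ mul0r !scale0r addr0.
  exists (M + e * M) => x y; rewrite /= TB (le_trans (T_le _))//.
  have fM := lip_normP f x y; rewrite mulrDl lerD// (le_trans (le _))//.
  by rewrite -mulrA ler_pM2l.
pose g : Lip0 X Y := MkLip0 gP.
exists g; split.
  apply: fO; rewrite -ball_normE /= distrC.
  have : lip_norm (g - f) <= e * M.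
    apply: lip_norm_le => [|x y]; first by rewrite mulr_ge0// ltW.
    rewrite [X in `|X| <= _](_ : _ = l (f x - f y) *: w); last first.
      change (T (f x) - f x - (T (f y) - f y) = l (f x - f y) *: w).
      by rewrite !TK -scalerBl (bounded_linearB _ _ lb).
    rewrite normrZ (le_trans (ler_piMr _ w_le1))// (le_trans (le _))//.
    by rewrite -mulrA ler_pM2l// lip_normP.
  by move=> /le_lt_trans; apply.
have [p] := choice Du; move=> /choice[q pq].
exists p, q, (T y0).
have Tu : T (u n) @[n --> \oo] --> T y0.
  apply: cvgD => //; apply: cvgZr_tmp; exact: bounded_linear_cvg lb uy0.
have Ty0 : `|T y0| = `|y0| + l y0.
  have -> : T y0 = (1 + l y0 / `|y0|) *: y0.
    by rewrite /T /w scalerA scalerDl scale1r.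
  rewrite normrZ ger0_norm; last by rewrite addr_ge0// divr_ge0.
  have [->|y00] := eqVneq y0 0; last by rewrite mulrDl mul1r divfK// normr_eq0.
  by rewrite -(scale0r 0) lZ normrZ normr0 !mul0r mulr0 addr0.
split.
- by move=> n; have [] := pq n.
- rewrite [RHS]/(lip_norm g); apply/eqP; rewrite eq_le; apply/andP; split.
    apply: (cvgr_to_le (cvg_norm Tu)); apply: nearW => n.
    have [pqn ->] := pq n; rewrite -Tslope /slope normrZ normfV normr_id.
    by rewrite ler_pdivrMl ?normr_gt0 ?subr_eq0// mulrC (lip_normP g).
  apply: lip_norm_le => // x y.
  have [->|xy] := eqVneq x y; first by rewrite !subrr !normr0 mulr0.
  have xy_gt0 : 0 < `|x - y| by rewrite normr_gt0 subr_eq0.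
  have Dxy : D (slope f x y) by exists x, y.
  have := le_trans (T_le _) (ly_le _ Dxy); rewrite Ty0 -Tslope /slope normrZ.
  by rewrite normfV normr_id ler_pdivrMl// mulrC.
- have -> : (fun n => `|p n - q n|^-1 *: (g (p n) - g (q n))) = T \o u.
    by apply/funext => n /=; have [_ ->] := pq n; rewrite -Tslope.
  exact: Tu.
Qed.
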